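(* Let $P_1,P_2,\dots$ be a trajectory of an extrinsic elliptic billiard around an ellipse $E$ with focal points $A,B$. Let $m,\tilde m$ be the circular surfaces with rotational symmetry generated by the discrete rolling ellipse construction, with meridian polygons $m_i=B_i$ and $\tilde m_i=A_i$, respectively. Then, with the unit Gauss map $s=(\tilde m-m)/|\tilde m-m|$, both pairs $(m,s)$ and $(\tilde m,-s)$ have constant mean curvature $H$, where $1/H=|A_iB_i|$ (which is independent of $i$) equals twice the semi-major axis of the ellipse $E$.
   Context: Extrinsic billiard: a trajectory is a polygonal curve $P_1,P_2,\dots$ in the plane of $E$ such that each segment $[P_i,P_{i+1}]$ touches the ellipse $E$ and consecutive triples $P_{i-1},P_i,P_{i+1}$ are not collinear. Discrete rolling ellipse construction: roll the trajectory onto a straight line $\ell$, i.e. place points, again denoted $P_1,P_2,\dots$, consecutively in this order on $\ell$ with the same distances $|P_iP_{i+1}|$. For each $i$ let $B_i$ be the point in a fixed one of the two half-planes bounded by $\ell$ such that the triangle $B_iP_iP_{i+1}$ is congruent (with this correspondence of vertices) to the triangle $BP_iP_{i+1}$ of the billiard; let $A_i$ be the point in the other half-plane such that $A_iP_iP_{i+1}$ is congruent to $AP_iP_{i+1}$. Surfaces of rotational symmetry: embed the plane in $\mathbb{R}^3$ and let $R$ be a rotation about the axis $\ell$ with angle not a multiple of $2\pi$. The surface generated by a meridian polygon $(m_i)$ is the quadrilateral mesh with vertices $m_{i,k}=R^k m_i$ and faces $f=(m_{i,k},m_{i+1,k},m_{i+1,k+1},m_{i,k+1})$; $\tilde m$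 is generated in the same way from $\tilde m_i=A_i$ with the same $R$, and $s=(\tilde m-m)/|\tilde m-m|$ is taken vertex-wise. (Corresponding edges of $m$, $\tilde m$ and $s$ are parallel.) Mean curvature: for parallel meshes $(m,s)$ with corresponding faces in parallel planes, $A(P)=\frac12\sum_i\det(p_i,p_{i+1})$ is the oriented area of a planar polygon, $A(P,Q)$ the associated symmetric bilinear form, and the mean curvature of a face with $A(m(f))\neq0$ is $H_f=-A(m(f),s(f))/A(m(f))$. Constant mean curvature $H$ means $H_f=H$ for all faces. *)

(* Defs.v *)
From HB Require Import structures.
From mathcomp Require Import all_boot all_order all_algebra.
From mathcomp Require Import boolp classical_sets reals trigo.

Set Implicit Arguments.
Unset Strict Implicit.
Unset Printing Implicit Defensive.

Import Order.TTheory GRing.Theory Num.Theory.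
Local Open Scope classical_set_scope.
Local Open Scope ring_scope.

Section Euclidean.
Variable R : realType.

Definition dotr n (x y : 'rV[R]_n) : R := (x *m y^T) 0 0.

(* The library norm on matrices is the sup norm, hence this Euclidean one. *)
Definition enorm n (x : 'rV[R]_n) : R := Num.sqrt (dotr x x).

Definition edist n (x y : 'rV[R]_n) : R := enorm (y - x).

Definition det2 (x y : 'rV[R]_2) : R := \det (\matrix_i [:: x; y]`_i).

Definition det3 (x y z : 'rV[R]_3) : R := \det (\matrix_i [:: x; y; z]`_i).

Definition cross (x y : 'rV[R]_3) : 'rV[R]_3 :=
  \row_k det3 x y (delta_mx 0 k).

(* The zero vector is parallel to every vector. *)
Definition parallel (x y : 'rV[R]_3) : Prop := cross x y = 0.

End Euclidean.

Section Billiard.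
Variable R : realType.
Implicit Types A B X Y Z : 'rV[R]_2.

(* For edist A B < 2 * a: the ellipse with foci A, B and semi-major axis a. *)
Definition ellipse A B (a : R) : set 'rV[R]_2 :=
  [set X | edist X A + edist X B = 2 * a].

Definition line X Y : set 'rV[R]_2 :=
  [set Z | exists t : R, Z = X + t *: (Y - X)].

Definition segment X Y : set 'rV[R]_2 :=
  [set Z | exists2 t : R, 0 <= t <= 1 & Z = X + t *: (Y - X)].

(* The line XY is tangent to the conic E, i.e. it has a single point in common
   with it, and the point of contact lies on the segment [X, Y]. *)
Definition segment_touches (E : set 'rV[R]_2) X Y : Prop :=
  exists2 T, segment X Y T & line X Y `&` E = [set T].

Definition collinear X Y Z : Prop := det2 (Y - X) (Z - X) = 0.

Definition billiard_trajectory (E : set 'rV[R]_2) (P : nat -> 'rV[R]_2) : Prop :=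
  (forall i, segment_touches E (P i) (P i.+1)) /\
  (forall i, ~ collinear (P i) (P i.+1) (P i.+2)).

End Billiard.

Section Rolling.
Variable R : realType.

Definition orthonormal_pair (u v : 'rV[R]_3) : Prop :=
  [/\ enorm u = 1, enorm v = 1 & dotr u v = 0].

(* Q is P laid out consecutively along the line through o with unit
   direction u. *)
Definition rolled_onto (o u : 'rV[R]_3) (P : nat -> 'rV[R]_2)
    (Q : nat -> 'rV[R]_3) : Prop :=
  exists t : nat -> R, forall i,
    [/\ Q i = o + t i *: u, t i < t i.+1
      & edist (Q i) (Q i.+1) = edist (P i) (P i.+1)].

(* The half-plane bounded by the line through o with direction u, on the side
   of v. *)
Definition half_plane (o u v : 'rV[R]_3) : set 'rV[R]_3 :=
  [set X | exists x y : R, 0 < y /\ X = o + x *: u + y *: v].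

Definition congruent m n (X Y Z : 'rV[R]_m) (X' Y' Z' : 'rV[R]_n) : Prop :=
  [/\ edist X Y = edist X' Y', edist Y Z = edist Y' Z'
    & edist Z X = edist Z' X'].

(* The focus F is carried along by the rolled trajectory Q, and its successive
   positions C i lie in the half-plane on the side of v. *)
Definition rolled_focus (o u v : 'rV[R]_3) (P : nat -> 'rV[R]_2)
    (Q : nat -> 'rV[R]_3) (F : 'rV[R]_2) (C : nat -> 'rV[R]_3) : Prop :=
  forall i, half_plane o u v (C i) /\
    congruent (C i) (Q i) (Q i.+1) F (P i) (P i.+1).

End Rolling.

Section Meshes.
Variable R : realType.

(* Rotation through theta about the axis through o with unit direction u
   (Rodrigues' formula). *)
Definition rotation (o u : 'rV[R]_3) (theta : R) (X : 'rV[R]_3) : 'rV[R]_3 :=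
  let x := X - o in
  o + cos theta *: x + sin theta *: cross u x
    + ((1 - cos theta) * dotr u x) *: u.

(* Vertices m i k; i runs along the meridian polygon. *)
Definition mesh := nat -> int -> 'rV[R]_3.

(* The k-th power of the rotation through theta is the rotation through
   k * theta. *)
Definition surface_of_rotation (o u : 'rV[R]_3) (theta : R)
    (mer : nat -> 'rV[R]_3) : mesh :=
  fun i k => rotation o u (k%:~R * theta) (mer i).

Definition gauss_map (m m' : mesh) : mesh :=
  fun i k => (enorm (m' i k - m i k))^-1 *: (m' i k - m i k).

Definition opp_mesh (s : mesh) : mesh := fun i k => - s i k.

Definition polygon n := 'I_n -> 'rV[R]_3.

Definition face (m : mesh) (i : nat) (k : int) : polygon 4 :=
  fun j => [:: m i k; m i.+1 k; m i.+1 (k + 1); m i (k + 1)]`_j.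

Definition unit_normal n (nu : 'rV[R]_3) (p : polygon n) : Prop :=
  enorm nu = 1 /\ forall j l, dotr nu (p l - p j) = 0.

(* For a polygon in a plane with unit normal nu, the planar determinant of the
   components parallel to this plane is det3 _ _ nu; ordS is the cyclic
   successor. *)
Definition area n (nu : 'rV[R]_3) (p : polygon n) : R :=
  2^-1 * \sum_(j < n) det3 (p j) (p (ordS j)) nu.

Definition mixed_area n (nu : 'rV[R]_3) (p q : polygon n) : R :=
  2^-1 * (area nu (fun j => p j + q j) - area nu p - area nu q).

Definition mean_curvature n (nu : 'rV[R]_3) (p q : polygon n) : R :=
  - mixed_area nu p q / area nu p.

Definition parallel_meshes (m s : mesh) : Prop := forall i k,
  parallel (m i.+1 k - m i k) (s i.+1 k - s i k) /\
  parallel (m i (k + 1) - m i k) (s i (k + 1) - s i k).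

(* As area nu (face m i k) != 0, the common unit normal nu is unique up to
   sign, and the mean curvature does not depend on this sign. *)
Definition constant_mean_curvature (m s : mesh) (H : R) : Prop :=
  parallel_meshes m s /\
  forall i k, exists nu,
    [/\ unit_normal nu (face m i k), unit_normal nu (face s i k),
        area nu (face m i k) != 0
      & mean_curvature nu (face m i k) (face s i k) = H].

Definition concyclic n (p : polygon n) : Prop :=
  exists (nu c : 'rV[R]_3) (r : R),
    [/\ enorm nu = 1, 0 < r
      & forall j, dotr nu (p j - c) = 0 /\ edist c (p j) = r].

Definition circular (m : mesh) : Prop := forall i k, concyclic (face m i k).

End Meshes.

(* Main.v *)
Require Import Defs.
From HB Require Import structures.
From mathcomp Require Import all_boot all_order all_algebra.
From mathcomp Require Import boolp classical_sets reals trigo.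
From mathcomp Require Import ring lra.

Set Implicit Arguments.
Unset Strict Implicit.
Unset Printing Implicit Defensive.

Import Order.TTheory GRing.Theory Num.Theory.
Local Open Scope ring_scope.

(** At a vertex X of the billiard let p and q be the unit directions of the two
    edges, at an angle with cosine c and sine s.  The foci of a conic are
    isogonal conjugates in the angle between two tangents: B - X = l p + m q
    and A - X = r (m p + l q), with positive l, m and r
    ([billiard_vertex_isogonal]).  The positive signs come from the contact
    points, which lie on the edges and not on their extensions.

    Rolling puts the triangles of the two edges side by side on the axis.  With
    abscissae x and signed distances y to the axis, the positions of B before
    and after X satisfy

      y_i = s m,  y_(i+1) = s l,  x_(i+1) - x_i = (l + m)(1 + c) > 0,

    and those of A, below the axis,

      y'_i = - r y_(i+1),  y'_(i+1) = - r y_i,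
      x'_(i+1) - x'_i = r (x_(i+1) - x_i).

    Hence the meridians have parallel edges.  Each face of the two surfaces is
    an isosceles trapezoid, so it is circular, and by these relations each
    diagonal of a face of one surface is parallel to the other diagonal of the
    corresponding face.  The mixed area is a quarter of the sum of the mixed
    determinants of the diagonals, so A(m, m') = 0 on every face
    ([trapezoid_mixed_area]).  The distance |A_i B_i| is 2 a, because unfolding
    A and B to opposite sides of a tangent turns the focal sum at the contact
    point into a straight segment ([unfolded_focal_distance]).  So
    s = (m' - m) / (2 a), and by bilinearity

      H = - A(m, s) / A(m) = (A(m) - A(m, m')) / (2 a A(m)) = 1 / (2 a).

    The relations are symmetric in m and m', with r replaced by 1 / r, and so
    (m', - s) is covered by the same argument.  The strict monotonicity of x
    matters when the rotation angle is pi: the faces then lie in a plane through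
    the axis, and their area would vanish if x stayed constant. *)

(** * Tangents of an ellipse and its foci *)

Section PlaneConic.
Variable R : realType.
Implicit Types (a d x y z w : R).

Lemma sqrt_sum_sqr_reverse_triangle x1 x2 y1 y2 :
  (Num.sqrt (x1 ^+ 2 + x2 ^+ 2) - Num.sqrt (y1 ^+ 2 + y2 ^+ 2)) ^+ 2
    <= (x1 - y1) ^+ 2 + (x2 - y2) ^+ 2.
Proof.
have hx : 0 <= x1 ^+ 2 + x2 ^+ 2 by rewrite addr_ge0 ?sqr_ge0.
have hy : 0 <= y1 ^+ 2 + y2 ^+ 2 by rewrite addr_ge0 ?sqr_ge0.
have := sqr_sqrtr hx; have := sqr_sqrtr hy.
have := sqrtr_ge0 (x1 ^+ 2 + x2 ^+ 2); have := sqrtr_ge0 (y1 ^+ 2 + y2 ^+ 2).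
set r := Num.sqrt (x1 ^+ 2 + _); set t := Num.sqrt _ => t0 r0 ht hr.
have rt0 : 0 <= r * t by rewrite mulr_ge0.
suff : x1 * y1 + x2 * y2 <= r * t.
  move=> h; rewrite sqrrB ht hr mulr2n; nra.
have [h|h] := leP (x1 * y1 + x2 * y2) 0; first exact: le_trans h rt0.
rewrite -(@ler_pXn2r _ 2) ?nnegrE ?(ltW h) // exprMn ht hr -subr_ge0.
by rewrite (_ : _ - _ = (x1 * y2 - x2 * y1) ^+ 2) ?sqr_ge0 //; ring.
Qed.

(** Squaring twice turns the focal sum into a polynomial equation.  The spurious
    solutions lie on the hyperbola where the distances differ by the major axis;
    it is empty, because this difference is bounded by the focal distance. *)
Lemma focal_sum_polynomial a d1 d2 : 0 <= d1 -> 0 <= d2 ->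
  (d1 - d2) ^+ 2 < (2 * a) ^+ 2 -> 0 < a ->
  (d1 + d2 = 2 * a <->
   16 * a ^+ 2 * d1 ^+ 2 = (4 * a ^+ 2 + d1 ^+ 2 - d2 ^+ 2) ^+ 2).
Proof.
move=> d10 d20 hd a0; split=> [h|h].
  have -> : a = (d1 + d2) / 2 by rewrite h; field.
  by field.
have : (2 * a - (d1 + d2)) * ((2 * a + (d1 + d2)) *
        ((2 * a) ^+ 2 - (d1 - d2) ^+ 2)) = 0.
  apply/eqP; rewrite -subr_eq0 subr0; move/eqP: h; rewrite -subr_eq0.
  by move=> /eqP h; apply/eqP; rewrite -[RHS]oppr0 -h; ring.
move/eqP; rewrite !mulf_eq0 => /or3P[/eqP h1|/eqP h1|/eqP h1]; lra.
Qed.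

(** The line is the first coordinate axis.  On it the equation of the ellipse is
    quadratic with positive leading coefficient, and a single solution means
    that its discriminant vanishes.  Up to a nonzero factor the discriminant is
    (4 a^2 - |AB|^2) (4 a^2 - |A'B|^2), where A' is the mirror image of A. *)
Lemma tangent_line_foci w1 w2 z1 z2 a x0 : 0 < a ->
  (z1 - w1) ^+ 2 + (z2 - w2) ^+ 2 < (2 * a) ^+ 2 ->
  (forall x, Num.sqrt ((w1 - x) ^+ 2 + w2 ^+ 2) +
             Num.sqrt ((z1 - x) ^+ 2 + z2 ^+ 2) = 2 * a <-> x = x0) ->
  (2 * a) ^+ 2 = (z1 - w1) ^+ 2 + (w2 + z2) ^+ 2 /\
  x0 * (w2 + z2) = w1 * z2 + z1 * w2.
Proof.
move=> a0 hAB hE.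
pose D := z1 - w1; pose K := 4 * a ^+ 2 + (w1 ^+ 2 + w2 ^+ 2) - (z1 ^+ 2 + z2 ^+ 2).
pose k := 16 * a ^+ 2 - 4 * D ^+ 2.
pose n := 16 * a ^+ 2 * w1 + 2 * D * K.
pose g := 16 * a ^+ 2 * (w1 ^+ 2 + w2 ^+ 2) - K ^+ 2.
have k0 : 0 < k.
  by rewrite /k; have := sqr_ge0 (z2 - w2); rewrite /D; lra.
have hG x : k * x ^+ 2 - 2 * n * x + g = 0 <-> x = x0.
  rewrite -hE; rewrite focal_sum_polynomial ?sqrtr_ge0 //; last first.
    apply: le_lt_trans (sqrt_sum_sqr_reverse_triangle _ _ _ _) _.
    by apply: le_lt_trans hAB; rewrite le_eqVlt; apply/orP; left; apply/eqP; ring.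
  rewrite !sqr_sqrtr ?addr_ge0 ?sqr_ge0 //.
  split=> h.
    apply/eqP; rewrite -subr_eq0; apply/eqP; rewrite -h /k /n /g /K /D; ring.
  move/eqP: h; rewrite -subr_eq0 => /eqP h.
  rewrite -h /k /n /g /K /D; ring.
have h0 : k * x0 ^+ 2 - 2 * n * x0 + g = 0 by apply/hG.
have kn0 : k != 0 by rewrite gt_eqF.
(* The second root is x0 as well. *)
have hx0 : k * x0 = n.
  have : 2 * n / k - x0 = x0.
    apply/hG; rewrite -[RHS]h0; field; exact: kn0.
  move=> h; have : 2 * n / k * k = (x0 + x0) * k by rewrite -{1}h; congr (_ * _); ring.
  by rewrite divfK //; lra.
have hdisc : n ^+ 2 - k * g = 0 by rewrite -[RHS](mulr0 (- k)) -h0 -hx0; ring.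
have hV : (4 * a ^+ 2 - D ^+ 2 - (w2 + z2) ^+ 2) = 0.
  have : a ^+ 2 * ((4 * a ^+ 2 - D ^+ 2 - (w2 + z2) ^+ 2) *
     (4 * a ^+ 2 - D ^+ 2 - (z2 - w2) ^+ 2)) = 0.
    by rewrite -[RHS](mulr0 (16^-1)) -hdisc /n /k /g /K /D; field.
  move/eqP; rewrite !mulf_eq0 => /orP[|/orP[]/eqP].
  - by rewrite orbb gt_eqF.
  - by [].
  - by move=> h; exfalso; move: hAB; rewrite /D in h; lra.
have ha : 4 * a ^+ 2 = D ^+ 2 + (w2 + z2) ^+ 2 by lra.
split; first by rewrite /D in ha; rewrite -ha; ring.
have S0 : w2 + z2 != 0.
  apply/eqP => h; rewrite h in ha; move: k0; rewrite /k; lra.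
apply: (mulfI S0); apply: (mulfI (_ : 4 != 0)); first by rewrite pnatr_eq0.
transitivity (k * x0).
  rewrite /k (_ : 16 * a ^+ 2 = 4 * (4 * a ^+ 2)); last by ring.
  rewrite ha; ring.
rewrite hx0 /n /K (_ : 16 * a ^+ 2 = 4 * (4 * a ^+ 2)); last by ring.
rewrite ha /D; ring.
Qed.

(** Let (l, m) and (l', m') be the coordinates of the foci, seen from a vertex,
    in the basis of the unit directions of the two edges, and [c] the scalar
    product of these directions.  Tangency to both edges gives l l' = m m': the
    lines to the two foci are isogonal, which leaves the signs of [l] and [m]
    free.  The positions [x0] and [y0] of the contact points on the two rays
    decide them: the other signs would put a contact point behind the
    vertex. *)
Lemma isogonal_foci_in_cone l m l' m' c x0 y0 :
  -1 < c -> c < 1 -> 0 < m * m' -> l * l' = m * m' -> 0 <= x0 -> 0 <= y0 ->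
  x0 * (m + m') = l * m' + m * l' + 2 * c * (m * m') ->
  y0 * (l + l') = l * m' + m * l' + 2 * c * (m * m') ->
  [/\ 0 < l, 0 < m, 0 < l' & 0 < m'].
Proof.
move=> c0 c1 b0 hb x00 y00; set X := _ + 2 * c * _ => hx hy.
have hX : ((l * m') * (m * l')) = (m * m') ^+ 2 by rewrite expr2 -{1}hb; ring.
set b := m * m' in b0 hb hX.
(* AM-GM, applied to l m' and m l' or to their opposites. *)
have key : forall p q : R, 0 <= p -> 0 <= q -> p * q = b ^+ 2 -> 2 * b <= p + q.
  move=> p q p0 q0 h; rewrite -(@ler_pXn2r _ 2) ?nnegrE //; [|lra|lra].
  by rewrite -subr_ge0 exprMn -h (_ : _ - _ = (p - q) ^+ 2) ?sqr_ge0 //; ring.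
have l0 : l != 0 by apply/eqP => e; move: hb b0; rewrite e mul0r => <-; rewrite ltxx.
have m0 : m != 0 by apply/eqP => e; move: b0; rewrite /b e mul0r ltxx.
have cb1 : c * b < b by rewrite gtr_pMl.
have cb2 : - b < c * b by rewrite -mulN1r ltr_pM2r.
have XE : X = l * m' + m * l' + 2 * (c * b) by rewrite /X /b; ring.
have bl : 0 < l * l' by rewrite hb.
case: (ltgtP m 0) m0 => // hm _; case: (ltgtP l 0) l0 => // hl _.
- have m'0 : m' < 0 by rewrite -(nmulr_rgt0 _ hm).
  have l'0 : l' < 0 by rewrite -(nmulr_rgt0 _ hl).
  have := key (l * m') (m * l').
  rewrite !nmulr_rge0 // (ltW m'0) (ltW l'0) => /(_ isT isT hX) h.
  have : x0 * (m + m') <= 0 by rewrite mulr_ge0_le0 //; lra.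
  lra.
- have m'0 : m' < 0 by rewrite -(nmulr_rgt0 _ hm).
  have l'0 : 0 < l' by rewrite -(pmulr_rgt0 _ hl).
  have := key (- (l * m')) (- (m * l')).
  rewrite mulrNN -mulrN -mulNr !pmulr_rge0 ?oppr_gt0 // oppr_ge0.
  rewrite (ltW m'0) (ltW l'0) => /(_ isT isT hX) h.
  have : 0 <= y0 * (l + l') by rewrite mulr_ge0 //; lra.
  lra.
- have m'0 : 0 < m' by rewrite -(pmulr_rgt0 _ hm).
  have l'0 : l' < 0 by rewrite -(nmulr_rgt0 _ hl).
  have := key (- (l * m')) (- (m * l')).
  rewrite mulrNN -mulNr -mulrN !pmulr_rge0 ?oppr_gt0 // oppr_ge0.
  rewrite (ltW m'0) (ltW l'0) => /(_ isT isT hX) h.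
  have : 0 <= x0 * (m + m') by rewrite mulr_ge0 //; lra.
  lra.
- by split=> //; [rewrite -(pmulr_rgt0 _ hl) | rewrite -(pmulr_rgt0 _ hm)].
Qed.

End PlaneConic.

(** * Euclidean vectors and the billiard in the plane *)

Section EuclideanVectors.
Variable R : realType.

Lemma dotrE n (x y : 'rV[R]_n) : dotr x y = \sum_j x 0 j * y 0 j.
Proof. by rewrite /dotr mxE; apply: eq_bigr => j _; rewrite mxE. Qed.

Lemma dotrDl n (x y z : 'rV[R]_n) : dotr (x + y) z = dotr x z + dotr y z.
Proof. by rewrite /dotr mulmxDl mxE. Qed.

Lemma dotrZl n a (x z : 'rV[R]_n) : dotr (a *: x) z = a * dotr x z.
Proof. by rewrite /dotr -scalemxAl mxE. Qed.

Lemma dotrC n (x y : 'rV[R]_n) : dotr x y = dotr y x.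
Proof. by rewrite !dotrE; apply: eq_bigr => j _; rewrite mulrC. Qed.

Lemma dotrDr n (x y z : 'rV[R]_n) : dotr z (x + y) = dotr z x + dotr z y.
Proof. by rewrite dotrC dotrDl !(dotrC z). Qed.

Lemma dotrZr n a (x z : 'rV[R]_n) : dotr z (a *: x) = a * dotr z x.
Proof. by rewrite dotrC dotrZl dotrC. Qed.

Lemma dotrNr n (x z : 'rV[R]_n) : dotr z (- x) = - dotr z x.
Proof. by rewrite -scaleN1r dotrZr mulN1r. Qed.

Lemma dotrNl n (x z : 'rV[R]_n) : dotr (- x) z = - dotr x z.
Proof. by rewrite dotrC dotrNr dotrC. Qed.

Lemma dotrBr n (x y z : 'rV[R]_n) : dotr z (x - y) = dotr z x - dotr z y.
Proof. by rewrite dotrDr dotrNr. Qed.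

Lemma dotr_ge0 n (x : 'rV[R]_n) : 0 <= dotr x x.
Proof. by rewrite dotrE sumr_ge0 // => j _; rewrite -expr2 sqr_ge0. Qed.

Lemma enorm_ge0 n (x : 'rV[R]_n) : 0 <= enorm x.
Proof. exact: sqrtr_ge0. Qed.

Lemma sqr_enorm n (x : 'rV[R]_n) : enorm x ^+ 2 = dotr x x.
Proof. by rewrite sqr_sqrtr // dotr_ge0. Qed.

Lemma enorm_eq n (x : 'rV[R]_n) r : 0 <= r -> dotr x x = r ^+ 2 -> enorm x = r.
Proof. by move=> r0 h; rewrite /enorm h sqrtr_sqr ger0_norm. Qed.

Lemma edistC n (x y : 'rV[R]_n) : edist x y = edist y x.
Proof.
by rewrite /edist /enorm -opprB -scaleN1r dotrZl dotrZr mulrA mulrNN !mul1r.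
Qed.

Lemma dotr2E (x y : 'rV[R]_2) : dotr x y = x 0 0 * y 0 0 + x 0 1 * y 0 1.
Proof.
rewrite dotrE big_ord_recl big_ord1 (_ : lift _ _ = 1) //; exact/val_inj.
Qed.

Lemma det2E (x y : 'rV[R]_2) : det2 x y = x 0 0 * y 0 1 - x 0 1 * y 0 0.
Proof.
rewrite /det2 (expand_det_row _ 0) big_ord_recl big_ord1.
rewrite /cofactor !det_mx11 !mxE /= !expr0 expr1.
rewrite (_ : lift 0 0 = 1); last exact/val_inj.
rewrite (_ : lift 1 0 = 0); last exact/val_inj.
by rewrite /= mul1r mulN1r mulrN.
Qed.

Section Tangent.
Variables (A B : 'rV[R]_2) (a : R).
Hypothesis hE : edist A B < 2 * a.

Let a_gt0 : 0 < a.
Proof. by have := le_lt_trans (enorm_ge0 (B - A)) hE; rewrite pmulr_rgt0. Qed.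

Lemma plane_decomposition (e x y : 'rV[R]_2) : dotr e e = 1 ->
  dotr x y = dotr e x * dotr e y + det2 e x * det2 e y.
Proof.
move=> he; rewrite -[LHS]mul1r -he !dotr2E !det2E; ring.
Qed.

Lemma segment_touches_sym (E : set 'rV[R]_2) X Y :
  segment_touches E X Y -> segment_touches E Y X.
Proof.
move=> [T [t /andP[t0 t1] hT] hl]; exists T.
  exists (1 - t); first by apply/andP; split; lra.
  by rewrite hT; apply/rowP => j; rewrite !mxE; ring.
rewrite -hl; congr setI; apply/seteqP; split=> _ [x ->]; exists (1 - x);
  by apply/rowP => j; rewrite !mxE; ring.
Qed.

Lemma touching_segment_foci X Y (l := edist X Y) (e := l^-1 *: (Y - X)) :
  0 < l -> segment_touches (ellipse A B a) X Y ->
  dotr e e = 1 /\ exists2 x0, 0 <= x0 &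
  (2 * a) ^+ 2 = dotr e (B - A) ^+ 2 + (det2 e (A - X) + det2 e (B - X)) ^+ 2 /\
  x0 * (det2 e (A - X) + det2 e (B - X)) =
    dotr e (A - X) * det2 e (B - X) + dotr e (B - X) * det2 e (A - X).
Proof.
move=> l0 [T [t /andP[t0 t1] hT] hl].
have he : dotr e e = 1.
  by rewrite dotrZl dotrZr -sqr_enorm -/(edist X Y) -/l; field; rewrite gt_eqF.
have YX : Y - X = l *: e by rewrite scalerA divff ?scale1r // gt_eqF.
clearbody e l.
have dAB : dotr e (B - A) = dotr e (B - X) - dotr e (A - X).
  by rewrite -dotrBr; congr dotr; apply/rowP => j; rewrite !mxE; ring.
split=> //; exists (t * l); first by rewrite mulr_ge0 // ltW.
have dist F x : edist (X + x *: e) F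
    = Num.sqrt ((dotr e (F - X) - x) ^+ 2 + det2 e (F - X) ^+ 2).
  rewrite /edist /enorm (plane_decomposition _ _ he) -!expr2; congr (Num.sqrt (_ + _)).
    by rewrite opprD addrA [in LHS]dotrBr dotrZr he mulr1.
  by congr (_ ^+ 2); rewrite !det2E !mxE; ring.
rewrite dAB; apply: tangent_line_foci => //.
  apply: le_lt_trans (_ : edist A B ^+ 2 < _); last first.
    by rewrite ltr_pXn2r // nnegrE ?enorm_ge0 // mulr_ge0 // ltW.
  rewrite sqr_enorm (plane_decomposition (B - A) (B - A) he) -!expr2 dAB.
  rewrite (_ : det2 e (B - A) = det2 e (B - X) - det2 e (A - X)) //.
  by rewrite !det2E !mxE; ring.
move=> x; rewrite -!dist; split=> [h|->].
  have : (line X Y `&` ellipse A B a)%classic (X + x *: e).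
    split=> //; exists (x / l); by rewrite YX scalerA divfK // gt_eqF.
  rewrite hl hT YX => /= /addrI h1.
  by have := congr1 (dotr e) h1; rewrite !dotrZr he !mulr1.
have : (line X Y `&` ellipse A B a)%classic T by rewrite hl.
by case=> _; rewrite /ellipse /= hT YX scalerA.
Qed.

(** The product of the signed distances of the foci to a tangent is the squared
    semi-minor axis, and is therefore the same for all tangents. *)
Lemma tangent_focal_product (e X : 'rV[R]_2) : dotr e e = 1 ->
  (2 * a) ^+ 2 = dotr e (B - A) ^+ 2 + (det2 e (A - X) + det2 e (B - X)) ^+ 2 ->
  (2 * a) ^+ 2 - edist A B ^+ 2 = 4 * (det2 e (A - X) * det2 e (B - X)).
Proof.
move=> he ->; rewrite sqr_enorm (plane_decomposition (B - A) (B - A) he).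
have -> : det2 e (B - A) = det2 e (B - X) - det2 e (A - X).
  by rewrite !det2E !mxE; ring.
by ring.
Qed.

Lemma minor_axis_gt0 : 0 < (2 * a) ^+ 2 - edist A B ^+ 2.
Proof.
by rewrite subr_gt0 ltr_pXn2r // nnegrE ?enorm_ge0 // mulr_ge0 // ltW.
Qed.

(** The right-hand side is the squared distance of the foci once they are
    unfolded to opposite sides of the tangent. *)
Lemma unfolded_focal_distance X Y (e := (edist X Y)^-1 *: (Y - X)) :
  0 < edist X Y -> segment_touches (ellipse A B a) X Y ->
  (2 * a) ^+ 2 =
    dotr e (B - A) ^+ 2 + (`|det2 e (A - X)| + `|det2 e (B - X)|) ^+ 2.
Proof.
move=> l0 h; have [he [x0 _ [h1 _]]] := touching_segment_foci l0 h.
have := minor_axis_gt0; rewrite (tangent_focal_product he h1) pmulr_rgt0 // => hp.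
rewrite {}h1 -/e in hp *; congr (_ + _).
by rewrite !sqrrD !real_normK ?num_real // -normrM gtr0_norm.
Qed.

(** In the basis p, q of unit vectors at an angle with cosine [c] and sine [s],
    the point [B] has coordinates (l, m) and [A] the coordinates (r m, r l).
    Only the projections onto the two directions and the distances to them are
    recorded, since only these survive the rolling. *)
Definition isogonal_foci X (p q : 'rV[R]_2) (l m r c s : R) : Prop :=
  [/\ [/\ 0 < l, 0 < m, 0 < r, 0 < s & -1 < c],
      [/\ dotr p (B - X) = l + m * c, dotr q (B - X) = l * c + m,
          `|det2 p (B - X)| = s * m & `|det2 q (B - X)| = s * l]
    & [/\ dotr p (A - X) = r * (m + l * c), dotr q (A - X) = r * (m * c + l),
          `|det2 p (A - X)| = s * (r * l) & `|det2 q (A - X)| = s * (r * m)]].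

(** The product of the distances of the foci to either edge line is the squared
    semi-minor axis; equating the two products gives the isogonality. *)
Lemma billiard_vertex_isogonal X' X Y
    (p := (edist X X')^-1 *: (X' - X)) (q := (edist X Y)^-1 *: (Y - X)) :
  0 < edist X X' -> 0 < edist X Y ->
  segment_touches (ellipse A B a) X' X -> segment_touches (ellipse A B a) X Y ->
  ~ collinear X' X Y ->
  exists l m r c s, isogonal_foci X p q l m r c s.
Proof.
move=> l1 l2 /segment_touches_sym h1 h2 hcol.
have [hp [x0 x00 [hp1 hp2]]] := touching_segment_foci l1 h1.
have [hq [y0 y00 [hq1 hq2]]] := touching_segment_foci l2 h2.
rewrite -/p in hp hp1 hp2; rewrite -/q in hq hq1 hq2.
pose s := det2 p q; pose c := dotr p q.
have s0 : s != 0.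
  apply/eqP => h; apply: hcol; rewrite /collinear.
  have -> : det2 (X - X') (Y - X') = - (edist X X' * edist X Y * s).
    rewrite /s /p /q; move: (edist X X') (edist X Y) l1 l2 => d d' l1 l2.
    by rewrite !det2E !mxE; field; rewrite !gt_eqF.
  by rewrite h mulr0 oppr0.
have cs : c ^+ 2 + s ^+ 2 = 1.
  by rewrite /c /s !expr2 -(plane_decomposition q q hp).
have s2 : 0 < s ^+ 2 by rewrite exprn_even_gt0.
have [c0 c1] : -1 < c /\ c < 1 by split; nra.
(* Cramer's rule for the coordinates of z along p and q. *)
pose al z := det2 z q / s; pose be z := det2 p z / s.
have dp z : dotr p z = al z + be z * c.
  apply: (mulIf s0); rewrite mulrDl [be z * c * s]mulrAC /al /be !divfK //.
  by rewrite -[X in X + _]mulr1 -hp /s /c !det2E !dotr2E; ring.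
have dq z : dotr q z = al z * c + be z.
  apply: (mulIf s0); rewrite mulrDl [al z * c * s]mulrAC /al /be !divfK //.
  by rewrite -[X in _ + X]mulr1 -hq /s /c !det2E !dotr2E; ring.
have ep z : det2 p z = be z * s by rewrite divfK.
have eq z : det2 q z = - (al z * s) by rewrite divfK // !det2E; ring.
have absp z : 0 < be z -> `|det2 p z| = `|s| * be z.
  by move=> h; rewrite ep normrM gtr0_norm // mulrC.
have absq z : 0 < al z -> `|det2 q z| = `|s| * al z.
  by move=> h; rewrite eq normrN normrM gtr0_norm // mulrC.
pose l := al (B - X); pose m := be (B - X).
pose l' := al (A - X); pose m' := be (A - X).
have b0 := minor_axis_gt0.
have bp := tangent_focal_product hp hp1.
have bq := tangent_focal_product hq hq1.
rewrite !ep -/m -/m' in bp hp2; rewrite !eq -/l -/l' in bq hq2.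
rewrite !dp -/m -/m' -/l -/l' in hp2; rewrite !dq -/l -/l' -/m -/m' in hq2.
have mm : 0 < m * m'.
  rewrite -(@pmulr_rgt0 _ (s ^+ 2)) //.
  have -> : s ^+ 2 * (m * m') = (m' * s) * (m * s) by ring.
  lra.
have ll : l * l' = m * m'.
  apply: (mulIf (expf_neq0 2 s0)).
  have -> : l * l' * s ^+ 2 = (- (l' * s) * - (l * s)) by ring.
  have -> : m * m' * s ^+ 2 = (m' * s) * (m * s) by ring.
  lra.
have [lp mp lp' mp'] : [/\ 0 < l, 0 < m, 0 < l' & 0 < m'].
  apply: (@isogonal_foci_in_cone _ l m l' m' c x0 y0) => //; apply: (mulIf s0).
    have -> : x0 * (m + m') * s = x0 * (m' * s + m * s) by ring.
    by rewrite hp2; ring.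
  have -> : y0 * (l + l') * s = - (y0 * (- (l' * s) - l * s)) by ring.
  by rewrite hq2 -ll; ring.
exists l, m, (l' / m), c, `|s|.
have lm : l' / m * m = l' by rewrite divfK // gt_eqF.
have ml : l' / m * l = m'.
  apply: (mulIf (lt0r_neq0 mp)).
  by rewrite mulrAC lm mulrC ll mulrC.
split.
- by split=> //; [exact: divr_gt0 | rewrite normr_gt0].
- by rewrite dp dq absp // absq.
- rewrite dp dq absp // absq // -/l' -/m' lm ml.
  by split=> //; rewrite mulrDr mulrA ?lm ?ml; ring.
Qed.

End Tangent.
End EuclideanVectors.

(** * Orthonormal frames and rotations in space *)

Section SpaceFrames.
Variable R : realType.
Implicit Types u v e o : 'rV[R]_3.

Lemma dotr3E (x y : 'rV[R]_3) :
  dotr x y = x 0 0 * y 0 0 + x 0 1 * y 0 1 + x 0 ord_max * y 0 ord_max.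
Proof.
rewrite dotrE !big_ord_recl big_ord0 addr0 addrA.
by congr (_ + _ * _ + _ * _); congr (_ 0 _); apply/val_inj.
Qed.

Lemma det3E (x y z : 'rV[R]_3) :
  det3 x y z = x 0 0 * (y 0 1 * z 0 ord_max - y 0 ord_max * z 0 1)
             - x 0 1 * (y 0 0 * z 0 ord_max - y 0 ord_max * z 0 0)
             + x 0 ord_max * (y 0 0 * z 0 1 - y 0 1 * z 0 0).
Proof.
rewrite /det3 (expand_det_row _ 0) !big_ord_recl big_ord0 addr0.
rewrite /cofactor !(expand_det_row _ 0) !big_ord_recl !big_ord0 !addr0.
rewrite /cofactor !det_mx11 !mxE /= !expr0 !exprS !expr0.
(* Entries indexed by natural numbers, so that the indices compute. *)
pose c (w : 'rV[R]_3) (n : nat) : R := w 0 (inord n).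
have cE (w : 'rV[R]_3) j : w 0 j = c w j by rewrite /c inord_val.
rewrite !cE /= /bump /=; ring.
Qed.

Lemma crossE (x y : 'rV[R]_3) :
  [/\ cross x y 0 0 = x 0 1 * y 0 ord_max - x 0 ord_max * y 0 1,
      cross x y 0 1 = x 0 ord_max * y 0 0 - x 0 0 * y 0 ord_max
    & cross x y 0 ord_max = x 0 0 * y 0 1 - x 0 1 * y 0 0].
Proof. by split; rewrite mxE det3E !mxE /=; ring. Qed.

Lemma row3P (x y : 'rV[R]_3) :
  x 0 0 = y 0 0 -> x 0 1 = y 0 1 -> x 0 ord_max = y 0 ord_max -> x = y.
Proof.
move=> h0 h1 h2; apply/rowP; case=> [[|[|[|//]]] h].
- by rewrite (_ : Ordinal h = 0) //; apply/val_inj.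
- by rewrite (_ : Ordinal h = 1) //; apply/val_inj.
- by rewrite (_ : Ordinal h = ord_max) //; apply/val_inj.
Qed.

Lemma crossC (x y : 'rV[R]_3) : cross x y = - cross y x.
Proof.
have [a1 a2 a3] := crossE x y; have [b1 b2 b3] := crossE y x.
by apply: row3P; rewrite [in RHS]mxE ?a1 ?a2 ?a3 ?b1 ?b2 ?b3; ring.
Qed.

Lemma crossDr (x y z : 'rV[R]_3) : cross z (x + y) = cross z x + cross z y.
Proof.
have [a1 a2 a3] := crossE z x; have [b1 b2 b3] := crossE z y.
have [c1 c2 c3] := crossE z (x + y).
by apply: row3P; rewrite [in RHS]mxE ?a1 ?a2 ?a3 ?b1 ?b2 ?b3 ?c1 ?c2 ?c3 !mxE; ring.
Qed.

Lemma crossZr a (x z : 'rV[R]_3) : cross z (a *: x) = a *: cross z x.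
Proof.
have [a1 a2 a3] := crossE z x; have [c1 c2 c3] := crossE z (a *: x).
by apply: row3P; rewrite [in RHS]mxE ?a1 ?a2 ?a3 ?c1 ?c2 ?c3 !mxE; ring.
Qed.

Lemma cross_collinear a b (x : 'rV[R]_3) : cross (a *: x) (b *: x) = 0.
Proof.
have [c1 c2 c3] := crossE (a *: x) (b *: x).
by apply: row3P; rewrite [in RHS]mxE ?c1 ?c2 ?c3 !mxE; ring.
Qed.

Lemma double_cross (x y z : 'rV[R]_3) :
  cross x (cross y z) = dotr x z *: y - dotr x y *: z.
Proof.
have [a1 a2 a3] := crossE y z; have [c1 c2 c3] := crossE x (cross y z).
apply: row3P; rewrite ?c1 ?c2 ?c3 ?a1 ?a2 ?a3 !mxE !dotr3E; ring.
Qed.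

Lemma dotr_crossr (x y : 'rV[R]_3) : dotr y (cross x y) = 0.
Proof. by have [a1 a2 a3] := crossE x y; rewrite dotr3E a1 a2 a3; ring. Qed.

Lemma dotr_crossl (x y : 'rV[R]_3) : dotr x (cross x y) = 0.
Proof. by rewrite crossC dotrNr dotr_crossr oppr0. Qed.

Lemma det3_cross (x y z : 'rV[R]_3) : det3 x y z = dotr (cross x y) z.
Proof.
by have [a1 a2 a3] := crossE x y; rewrite dotr3E a1 a2 a3 det3E; ring.
Qed.

Lemma dotr_cross_cross (x y : 'rV[R]_3) :
  dotr (cross x y) (cross x y) = dotr x x * dotr y y - dotr x y ^+ 2.
Proof.
by have [a1 a2 a3] := crossE x y; rewrite !dotr3E a1 a2 a3; ring.
Qed.

Lemma orthonormal_pairE u v : orthonormal_pair u v ->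
  [/\ dotr u u = 1, dotr v v = 1, dotr u v = 0,
      dotr (cross u v) (cross u v) = 1 & cross u (cross u v) = - v].
Proof.
move=> [hu hv huv]; have uu : dotr u u = 1 by rewrite -sqr_enorm hu expr1n.
have vv : dotr v v = 1 by rewrite -sqr_enorm hv expr1n.
split=> //; first by rewrite dotr_cross_cross uu vv huv expr0n subr0 mulr1.
by rewrite double_cross uu huv scale0r sub0r scale1r.
Qed.

Definition frame_vec u e (x y z : R) := x *: u + y *: e + z *: cross u e.

Lemma dotr_frame u e x y z x' y' z' : orthonormal_pair u e ->
  dotr (frame_vec u e x y z) (frame_vec u e x' y' z')
    = x * x' + y * y' + z * z'.
Proof.
move=> /orthonormal_pairE[uu ee ue nn _].
rewrite /frame_vec !(dotrDl, dotrDr, dotrZl, dotrZr).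
rewrite (dotrC e u) !(dotrC (cross u e)) dotr_crossl dotr_crossr nn uu ee ue.
ring.
Qed.

Lemma frame_vecD u e x y z x' y' z' :
  frame_vec u e x y z + frame_vec u e x' y' z'
    = frame_vec u e (x + x') (y + y') (z + z').
Proof. by rewrite /frame_vec !scalerDl addrACA; congr (_ + _); rewrite addrACA. Qed.

Lemma frame_vecZ u e a x y z :
  a *: frame_vec u e x y z = frame_vec u e (a * x) (a * y) (a * z).
Proof. by rewrite /frame_vec !scalerDr !scalerA. Qed.

Lemma frame_vecB u e x y z x' y' z' :
  frame_vec u e x y z - frame_vec u e x' y' z'
    = frame_vec u e (x - x') (y - y') (z - z').
Proof. by rewrite -scaleN1r frame_vecZ frame_vecD !mulN1r. Qed.

Lemma det3_frame u e x y z x' y' z' x'' y'' z'' : orthonormal_pair u e ->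
  det3 (frame_vec u e x y z) (frame_vec u e x' y' z')
       (frame_vec u e x'' y'' z'')
  = x * (y' * z'' - z' * y'') - y * (x' * z'' - z' * x'')
      + z * (x' * y'' - y' * x'').
Proof.
move=> /orthonormal_pairE[_ _ _ nn _].
have hn : det3 u e (cross u e) = 1 by rewrite det3_cross.
transitivity ((x * (y' * z'' - z' * y'') - y * (x' * z'' - z' * x'')
      + z * (x' * y'' - y' * x'')) * det3 u e (cross u e)); last first.
  by rewrite hn mulr1.
rewrite /frame_vec !det3E !mxE; ring.
Qed.

Definition ray u v phi := cos phi *: v + sin phi *: cross u v.

Lemma cross_ray u v phi : orthonormal_pair u v ->
  cross u (ray u v phi) = cos phi *: cross u v - sin phi *: v.
Proof.
by move=> /orthonormal_pairE[_ _ _ _ h]; rewrite crossDr !crossZr h scalerN.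
Qed.

Lemma ray_orthonormal u v phi : orthonormal_pair u v ->
  orthonormal_pair u (ray u v phi).
Proof.
move=> huv; have [uu vv uv nn _] := orthonormal_pairE huv.
split; first by case: huv.
  apply: enorm_eq => //; rewrite expr1n.
  rewrite !(dotrDl, dotrDr, dotrZl, dotrZr) (dotrC (cross u v) v).
  by rewrite dotr_crossr nn vv !mulr0 addr0 add0r !mulr1 -!expr2 cos2Dsin2.
by rewrite dotrDr !dotrZr uv dotr_crossl !mulr0 addr0.
Qed.

Lemma ray_add u v phi psi : orthonormal_pair u v ->
  ray u v (phi + psi)
    = cos psi *: ray u v phi + sin psi *: cross u (ray u v phi).
Proof.
move=> huv; rewrite cross_ray // /ray cosD sinD.
by apply/rowP => j; rewrite !mxE; ring.
Qed.

Lemma rotation_ray o u v x y phi : orthonormal_pair u v ->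
  rotation o u phi (o + x *: u + y *: v) = o + x *: u + y *: ray u v phi.
Proof.
move=> /orthonormal_pairE[uu vv uv _ _]; rewrite /rotation /=.
have -> : o + x *: u + y *: v - o = x *: u + y *: v.
  by apply/rowP => j; rewrite !mxE; ring.
rewrite dotrDr !dotrZr uu uv crossDr !crossZr (_ : cross u u = 0); last first.
  by rewrite -[u]scale1r cross_collinear.
by rewrite /ray; apply/rowP => j; rewrite !mxE; ring.
Qed.

(** After reduction of theta modulo 2 pi its half lies in the open interval
    from 0 to pi, where the sine is positive; the reduction leaves
    cos theta = 1 - 2 sin^2 (theta / 2) unchanged. *)
Lemma sin_half_neq0 (theta : R) :
  (forall k : int, theta <> k%:~R * (2 * pi)) -> sin (theta / 2) != 0.
Proof.
move=> h; apply/eqP => h0.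
have pi0 : 0 < pi :> R := pi_gt0 R.
pose n := Num.floor (theta / (2 * pi)).
pose t := theta - n%:~R * (2 * pi).
have [t0 t1] : 0 < t /\ t < 2 * pi.
  have /andP[h1 h2] := floor_itv (theta / (2 * pi)).
  rewrite -/n ler_pdivlMr ?mulr_gt0 // in h1.
  rewrite -/n ltr_pdivrMr ?mulr_gt0 // intrD mulrDl mul1r in h2.
  split; last by rewrite /t; lra.
  by rewrite /t subr_gt0 lt_neqAle h1 andbT eq_sym; apply/eqP/h.
have cosn (x : R) (m : nat) : cos (x + (m%:R * (2 * pi))) = cos x.
  rewrite -[RHS](periodicn (@cosD2pi R) m x); congr (cos (_ + _)).
  by rewrite !mulr_natl.
have ct : cos t = cos theta.
  rewrite /t; case: (n) => m.
    by rewrite -[LHS](cosn _ m) subrK.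
  by rewrite NegzE mulrNz mulNr opprK; apply: cosn.
have half (x : R) : cos x = 1 - 2 * sin (x / 2) ^+ 2.
  have {1}-> : x = x / 2 + x / 2 by field.
  by rewrite cosD -!expr2 cos2sin2; ring.
have hs : sin (t / 2) ^+ 2 = 0 by move: ct; rewrite !half h0; lra.
have : 0 < sin (t / 2) by apply: sin_gt0_pi; apply/andP; split; lra.
by move/eqP: hs; rewrite sqrf_eq0 => /eqP ->; rewrite ltxx.
Qed.

End SpaceFrames.

(** * Areas of quadrilaterals and surfaces of rotation *)

Section QuadrilateralAreas.
Variable R : realType.
Implicit Types (nu : 'rV[R]_3) (p q : polygon R 4).

(** The diagonals do not depend on the origin, whereas the position vectors in
    the definition of the area do. *)
Lemma area_diagonals nu p :
  area nu p = 2^-1 * det3 (p 2 - p 0) (p 3 - p 1) nu.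
Proof.
rewrite /area !big_ord_recl big_ord0 addr0; congr (_ * _).
have h1 : lift ord0 ord0 = 1 :> 'I_4 by exact/val_inj.
have h2 : lift ord0 (lift ord0 ord0) = 2 :> 'I_4 by exact/val_inj.
have h3 : lift ord0 (lift ord0 (lift ord0 ord0)) = 3 :> 'I_4 by exact/val_inj.
rewrite h1 h2 h3.
have -> : ordS ord0 = 1 :> 'I_4 by exact/val_inj.
have -> : ordS 1 = 2 :> 'I_4 by exact/val_inj.
have -> : ordS 2 = 3 :> 'I_4 by exact/val_inj.
have -> : ordS 3 = 0 :> 'I_4 by exact/val_inj.
by rewrite (_ : ord0 = 0) // !det3E !mxE; ring.
Qed.

Lemma mixed_area_diagonals nu p q :
  mixed_area nu p q = 4^-1 * (det3 (p 2 - p 0) (q 3 - q 1) nu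
                            + det3 (q 2 - q 0) (p 3 - p 1) nu).
Proof. rewrite /mixed_area !area_diagonals !det3E !mxE; by field. Qed.

(** By bilinearity the mean curvature is (A(p) - A(p, q)) / (d A(p)). *)
Lemma mean_curvature_dual nu p q (d : R) : area nu p != 0 ->
  mixed_area nu p q = 0 ->
  mean_curvature nu p (fun j => d^-1 *: (q j - p j)) = d^-1.
Proof.
move=> hp hpq; rewrite /mean_curvature.
have -> : mixed_area nu p (fun j => d^-1 *: (q j - p j))
    = d^-1 * (mixed_area nu p q - area nu p).
  rewrite !mixed_area_diagonals area_diagonals !det3E !mxE; move: d^-1 => r.
  by field.
by rewrite hpq sub0r mulrN opprK mulfK.
Qed.

Lemma unit_normal_plane n nu c (p : polygon R n) :
  enorm nu = 1 -> (forall j, dotr nu (p j) = c) -> unit_normal nu p.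
Proof. by move=> h hc; split=> // j l; rewrite dotrBr !hc subrr. Qed.

End QuadrilateralAreas.

Section SurfacesOfRotation.
Variable R : realType.
Implicit Types (o u v e : 'rV[R]_3) (theta : R).

(** A face between two meridians, in a frame whose second vector [e] points
    halfway between them; [C] and [S] are cosine and sine of half the rotation
    angle. *)
Definition trapezoid o u e (C S x y x' y' : R) : polygon R 4 := fun j =>
  o + [:: frame_vec u e x (C * y) (- (S * y));
          frame_vec u e x' (C * y') (- (S * y'));
          frame_vec u e x' (C * y') (S * y');
          frame_vec u e x (C * y) (S * y)]`_j.

Lemma ord4P (P : 'I_4 -> Prop) : P 0 -> P 1 -> P 2 -> P 3 -> forall j, P j.
Proof.
move=> h0 h1 h2 h3; case=> [[|[|[|[|//]]]] h].
- by rewrite (_ : Ordinal h = 0) //; apply/val_inj.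
- by rewrite (_ : Ordinal h = 1) //; apply/val_inj.
- by rewrite (_ : Ordinal h = 2) //; apply/val_inj.
- by rewrite (_ : Ordinal h = 3) //; apply/val_inj.
Qed.

Section Trapezoid.
Variables (o u e : 'rV[R]_3) (C S x y x' y' : R).
Hypothesis hue : orthonormal_pair u e.
Hypotheses (S0 : S != 0) (x0 : x != x').

Let D2 := (x' - x) ^+ 2 + (C * (y' - y)) ^+ 2.
Let D := Num.sqrt D2.
Let nu := D^-1 *: frame_vec u e (- (C * (y' - y))) (x' - x) 0.
Let p := trapezoid o u e C S x y x' y'.

Lemma leg_sqr_gt0 : 0 < D2.
Proof.
by rewrite ltr_wpDr ?sqr_ge0 // exprn_even_gt0 //= subr_eq0 eq_sym.
Qed.

Let D0 : 0 < D. Proof. by rewrite sqrtr_gt0 leg_sqr_gt0. Qed.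
Let DD : D ^+ 2 = D2. Proof. by rewrite sqr_sqrtr // ltW // leg_sqr_gt0. Qed.

Lemma trapezoid_nu : enorm nu = 1.
Proof.
apply: enorm_eq => //; rewrite expr1n /nu dotrZl dotrZr dotr_frame //.
have -> : - (C * (y' - y)) * - (C * (y' - y)) + (x' - x) * (x' - x) + 0 * 0 = D ^+ 2.
  by rewrite DD /D2; ring.
by field; rewrite gt_eqF.
Qed.

Lemma dotr_nu_trapezoid X Y X' Y' :
  (x' - x) * (Y' - Y) = (X' - X) * (y' - y) ->
  forall j, dotr nu (trapezoid o u e C S X Y X' Y' j)
    = dotr nu o + D^-1 * ((x' - x) * (C * Y) - C * (y' - y) * X).
Proof.
move=> h; rewrite /trapezoid /nu => j; rewrite dotrDr; congr (_ + _).
rewrite dotrZl; congr (_ * _); move: j.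
have key : (x' - x) * (C * Y') - C * (y' - y) * X'
    = (x' - x) * (C * Y) - C * (y' - y) * X.
  apply/eqP; rewrite -subr_eq0; apply/eqP.
  transitivity (C * ((x' - x) * (Y' - Y) - (X' - X) * (y' - y))); first by ring.
  by rewrite h subrr mulr0.
by apply: ord4P; rewrite /= dotr_frame //; [|rewrite -key|rewrite -key|]; ring.
Qed.

Lemma trapezoid_diagonals X Y X' Y' (q := trapezoid o u e C S X Y X' Y') :
  q 2 - q 0 = frame_vec u e (X' - X) (C * (Y' - Y)) (S * (Y + Y')) /\
  q 3 - q 1 = frame_vec u e (X - X') (C * (Y - Y')) (S * (Y + Y')).
Proof.
by split; rewrite /q /trapezoid /= opprD addrACA subrr add0r frame_vecB;
  congr frame_vec; ring.
Qed.

Lemma nu_frame : nu = frame_vec u e (- (C * (y' - y)) / D) ((x' - x) / D) 0.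
Proof. by rewrite /nu frame_vecZ mulr0; congr frame_vec; rewrite mulrC. Qed.

Lemma trapezoid_area : area nu p = - (S * (y + y') * D).
Proof.
rewrite area_diagonals; have [-> ->] := trapezoid_diagonals x y x' y'.
rewrite nu_frame det3_frame //.
apply: (mulIf (lt0r_neq0 D0)).
have -> : - (S * (y + y') * D) * D = - (S * (y + y') * D ^+ 2) by ring.
rewrite DD /D2.
by field; rewrite gt_eqF.
Qed.

(** Each diagonal of one trapezoid is parallel to the other diagonal of the
    second one, so both determinants in the mixed area vanish. *)
Lemma trapezoid_mixed_area rho X X' : X' - X = rho * (x' - x) ->
  mixed_area nu p (trapezoid o u e C S X (- rho * y') X' (- rho * y)) = 0.
Proof.
move=> h; rewrite mixed_area_diagonals; have [-> ->] := trapezoid_diagonals x y x' y'.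
have [-> ->] := trapezoid_diagonals X (- rho * y') X' (- rho * y).
rewrite nu_frame !det3_frame // h (_ : X - X' = - (rho * (x' - x))) -?h; last by ring.
by rewrite h; field; rewrite gt_eqF.
Qed.

(** The trapezoid is isosceles, so the centre is sought on its axis of symmetry,
    the line joining the midpoints of the parallel sides. *)
Lemma trapezoid_concyclic : y != 0 -> concyclic p.
Proof.
move=> y0.
(* Equal distances from the centre to the ends of both parallel sides are a
   linear equation for [t]. *)
pose t := 2^-1 + S ^+ 2 * (y' ^+ 2 - y ^+ 2) / (2 * D2).
pose r2 := t ^+ 2 * D2 + (S * y) ^+ 2.
have r20 : 0 < r2.
  apply: ltr_wpDl; last by rewrite exprn_even_gt0 //= mulf_neq0.
  by rewrite mulr_ge0 ?sqr_ge0 // ltW // leg_sqr_gt0.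
pose c := o + frame_vec u e (x + t * (x' - x)) (C * (y + t * (y' - y))) 0.
exists nu, c, (Num.sqrt r2); split; first exact: trapezoid_nu.
  by rewrite sqrtr_gt0.
have ht : t * (2 * D2) = D2 + S ^+ 2 * (y' ^+ 2 - y ^+ 2).
  by rewrite /t; field; rewrite gt_eqF ?leg_sqr_gt0.
have hr : forall X Y Z, (X - (x + t * (x' - x))) ^+ 2 +
    (Y - (C * (y + t * (y' - y)))) ^+ 2 + Z ^+ 2 = r2 ->
    edist c (o + frame_vec u e X Y Z) = Num.sqrt r2.
  move=> X Y Z h; rewrite /edist /enorm /c opprD addrACA subrr add0r.
  by rewrite frame_vecB dotr_frame // -h subr0 -!expr2.
move=> j; split.
  rewrite dotrBr dotr_nu_trapezoid // /c dotrDr /nu [in X in _ - (_ + X)]dotrZl.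
  rewrite dotr_frame //; ring.
have hD : D2 = (x' - x) ^+ 2 + (C * (y' - y)) ^+ 2 by [].
move: j; apply: ord4P; rewrite /p /trapezoid /=; apply: hr.
- by rewrite /r2 hD; ring.
- rewrite /r2; transitivity (D2 + S ^+ 2 * y' ^+ 2 + t ^+ 2 * D2 - t * (2 * D2)).
    by rewrite hD; ring.
  by rewrite ht; ring.
- rewrite /r2; transitivity (D2 + S ^+ 2 * y' ^+ 2 + t ^+ 2 * D2 - t * (2 * D2)).
    by rewrite hD; ring.
  by rewrite ht; ring.
- by rewrite /r2 hD; ring.
Qed.

Lemma trapezoid_mean_curvature rho X X' d :
  y + y' != 0 -> X' - X = rho * (x' - x) ->
  let q := trapezoid o u e C S X (- rho * y') X' (- rho * y) in
  exists nu, [/\ unit_normal nu p,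
    unit_normal nu (fun j => d^-1 *: (q j - p j)),
    area nu p != 0 &
    mean_curvature nu p (fun j => d^-1 *: (q j - p j)) = d^-1].
Proof.
move=> hy hX q; exists nu.
have hp := dotr_nu_trapezoid (erefl ((x' - x) * (y' - y))).
have hXY : (x' - x) * (- rho * y - - rho * y') = (X' - X) * (y' - y).
  by rewrite hX; ring.
have hq := dotr_nu_trapezoid hXY.
have ha : area nu p != 0.
  by rewrite trapezoid_area oppr_eq0 !mulf_neq0 // gt_eqF.
split=> //.
- exact: unit_normal_plane trapezoid_nu hp.
- apply: unit_normal_plane trapezoid_nu _ => j.
  by rewrite dotrZr dotrBr hp hq.
- exact: mean_curvature_dual ha (trapezoid_mixed_area hX).
Qed.

End Trapezoid.

Definition meridian o u v (x y : nat -> R) : nat -> 'rV[R]_3 :=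
  fun i => o + x i *: u + y i *: v.

Variables (o u v : 'rV[R]_3) (theta : R).
Hypothesis huv : orthonormal_pair u v.

Let surface x y := surface_of_rotation o u theta (meridian o u v x y).
Let mid (k : int) := ray u v (k%:~R * theta + theta / 2).
Let C := cos (theta / 2).
Let S := sin (theta / 2).

Lemma surface_vertex x y i k :
  surface x y i k = o + x i *: u + y i *: ray u v (k%:~R * theta).
Proof. exact: rotation_ray. Qed.

(** Both neighbouring meridian planes are half a rotation angle away from the
    direction [mid k]. *)
Lemma surface_face x y i k : face (surface x y) i k =
  trapezoid o u (mid k) C S (x i) (y i) (x i.+1) (y i.+1).
Proof.
have hm : ray u v (k%:~R * theta) = C *: mid k - S *: cross u (mid k).
  rewrite (_ : k%:~R * theta = k%:~R * theta + theta / 2 + - (theta / 2)).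
    by rewrite ray_add // cosN sinN scaleNr.
  by rewrite addrK.
have hp : ray u v ((k + 1)%:~R * theta) = C *: mid k + S *: cross u (mid k).
  rewrite (_ : (k + 1)%:~R * theta = k%:~R * theta + theta / 2 + theta / 2).
    by rewrite ray_add.
  by rewrite intrD mulrDl mul1r; field.
apply/funext; apply: ord4P; rewrite /face /trapezoid /= surface_vertex ?hm ?hp;
  by rewrite /frame_vec; apply/rowP => j; rewrite !mxE; ring.
Qed.

Hypothesis S0 : S != 0.

Lemma surface_circular (x y : nat -> R) :
  (forall i, x i != x i.+1) -> (forall i, y i != 0) -> circular (surface x y).
Proof.
move=> hx hy i k; rewrite surface_face; apply: trapezoid_concyclic => //.
exact: ray_orthonormal.
Qed.

(** The relations between the heights make the edges of the two meridians
    parallel with ratio [rho] and, at the same time, the mixed areas of the faces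
    vanish. *)
Lemma surface_cmc (x y X Y rho : nat -> R) (d : R) : 0 < d ->
  (forall i, x i != x i.+1) -> (forall i, y i + y i.+1 != 0) ->
  (forall i, X i.+1 - X i = rho i * (x i.+1 - x i)) ->
  (forall i, Y i = - rho i * y i.+1) -> (forall i, Y i.+1 = - rho i * y i) ->
  (forall i, (X i - x i) ^+ 2 + (Y i - y i) ^+ 2 = d ^+ 2) ->
  constant_mean_curvature (surface x y)
    (gauss_map (surface x y) (surface X Y)) d^-1.
Proof.
move=> d0 hx hy hX hY hY' hd.
have hs i k : gauss_map (surface x y) (surface X Y) i k
    = d^-1 *: (surface X Y i k - surface x y i k).
  rewrite /gauss_map (enorm_eq (ltW d0)) // !surface_vertex.
  set w := ray u v _.
  have [uu ww uw _ _] := orthonormal_pairE (ray_orthonormal (k%:~R * theta) huv).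
  rewrite -/w in ww uw; clearbody w.
  have -> : o + X i *: u + Y i *: w - (o + x i *: u + y i *: w)
     = (X i - x i) *: u + (Y i - y i) *: w.
    by apply/rowP => j; rewrite !mxE; ring.
  rewrite !(dotrDl, dotrDr, dotrZl, dotrZr) (dotrC w u) uu ww uw -(hd i); ring.
split=> [i k|i k].
  split.
    have -> : surface x y i.+1 k - surface x y i k =
       1 *: (surface x y i.+1 k - surface x y i k) by rewrite scale1r.
    have -> : gauss_map (surface x y) (surface X Y) i.+1 k -
      gauss_map (surface x y) (surface X Y) i k =
      ((rho i - 1) / d) *: (surface x y i.+1 k - surface x y i k).
      have hXi : X i.+1 = X i + rho i * (x i.+1 - x i) by rewrite -hX; ring.
      rewrite !hs !surface_vertex hXi (hY' i) (hY i).
      by apply/rowP => j; rewrite !mxE; ring.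
    exact: cross_collinear.
  rewrite !hs !surface_vertex.
  set w := ray u v _; set w' := ray u v _.
  have -> : o + x i *: u + y i *: w - (o + x i *: u + y i *: w') = y i *: (w - w').
    by apply/rowP => j; rewrite !mxE; ring.
  have -> : d^-1 *: (o + X i *: u + Y i *: w - (o + x i *: u + y i *: w)) -
     d^-1 *: (o + X i *: u + Y i *: w' - (o + x i *: u + y i *: w'))
    = (d^-1 * (Y i - y i)) *: (w - w').
    by apply/rowP => j; rewrite !mxE; ring.
  exact: cross_collinear.
have -> : face (gauss_map (surface x y) (surface X Y)) i k =
   fun j => d^-1 *: (face (surface X Y) i k j - face (surface x y) i k j).
  by apply/funext; apply: ord4P; rewrite /face /= hs.
rewrite !surface_face (hY' i) (hY i); apply: trapezoid_mean_curvature => //.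
exact: ray_orthonormal.
Qed.

End SurfacesOfRotation.

(** * Rolling the billiard onto a line *)

Section RolledFoci.
Variable R : realType.
Variables (o u : 'rV[R]_3) (P : nat -> 'rV[R]_2) (Q : nat -> 'rV[R]_3).
Variable t : nat -> R.
Hypothesis ht : forall i, [/\ Q i = o + t i *: u, t i < t i.+1
      & edist (Q i) (Q i.+1) = edist (P i) (P i.+1)].

Let fwd i := (edist (P i) (P i.+1))^-1 *: (P i.+1 - P i).
Let bwd i := (edist (P i.+1) (P i))^-1 *: (P i - P i.+1).

Lemma rolled_edge_length i : dotr u u = 1 ->
  edist (P i) (P i.+1) = t i.+1 - t i.
Proof.
move=> uu; have [hQ hlt <-] := ht i; have [hQ' _ _] := ht i.+1.
apply: enorm_eq; first by rewrite subr_ge0 ltW.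
rewrite hQ hQ' opprD addrACA subrr add0r -scalerBl dotrZl dotrZr uu; ring.
Qed.

(** Congruence with the billiard triangle fixes the distances of the rolled
    focus to both ends of its edge, hence its abscissa and its height.  They are
    expressed from either end: the edges before and after a vertex have to be
    compared at that vertex. *)
Lemma rolled_focus_meridian v (F : 'rV[R]_2) (Cs : nat -> 'rV[R]_3) :
  orthonormal_pair u v -> rolled_focus o u v P Q F Cs ->
  exists x y : nat -> R, Cs = meridian o u v x y /\
  forall i,
    [/\ 0 < y i, x i = t i + dotr (fwd i) (F - P i),
        y i = `|det2 (fwd i) (F - P i)|,
        x i = t i.+1 - dotr (bwd i) (F - P i.+1)
      & y i = `|det2 (bwd i) (F - P i.+1)|].
Proof.
move=> huv hF; have [uu vv uv _ _] := orthonormal_pairE huv.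
have hC i : Cs i = meridian o u v (fun i => dotr u (Cs i - o))
                     (fun i => dotr v (Cs i - o)) i /\ 0 < dotr v (Cs i - o).
  have [[x [y [y0 hxy]]] _] := hF i.
  have hCo : Cs i - o = x *: u + y *: v.
    by rewrite hxy; apply/rowP => j; rewrite !mxE; ring.
  rewrite /meridian hCo !dotrDr !dotrZr (dotrC v u) uu vv uv.
  by rewrite !mulr0 !mulr1 addr0 add0r -hxy.
exists (fun i => dotr u (Cs i - o)), (fun i => dotr v (Cs i - o)).
split; first by apply/funext => i; case: (hC i).
move=> i; have [] := hC i; rewrite /meridian.
move: (dotr u _) (dotr v _) => x y hxy y0.
have [_ [hd1 _ hd2]] := hF i; have hl := rolled_edge_length i uu.
have [hQ hlt _] := ht i; have [hQ' _ _] := ht i.+1.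
have sq z : dotr (z *: u - y *: v) (z *: u - y *: v) = z ^+ 2 + y ^+ 2.
  by rewrite -scaleNr !(dotrDl, dotrDr, dotrZl, dotrZr) (dotrC v u) uu vv uv; ring.
have l0 : 0 < t i.+1 - t i by rewrite subr_gt0.
set l := t i.+1 - t i in l0 hl.
have ff : dotr (fwd i) (fwd i) = 1.
  by rewrite dotrZl dotrZr -sqr_enorm -/(edist _ _) hl; field; rewrite gt_eqF.
have PP : P i.+1 - P i = l *: fwd i.
  by rewrite /fwd hl scalerA divff ?scale1r // gt_eqF.
have bE : bwd i = - fwd i by rewrite /bwd /fwd edistC -scalerN opprB.
set f := fwd i in ff PP bE *; clearbody f.
have hb : dotr (bwd i) (F - P i.+1) = l - dotr (f) (F - P i).
  have -> : F - P i.+1 = (F - P i) - l *: f.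
    by rewrite -PP; apply/rowP => j; rewrite !mxE; ring.
  by rewrite bE dotrNl [in LHS]dotrBr dotrZr ff; ring.
have hdb : det2 (bwd i) (F - P i.+1) = - det2 (f) (F - P i).
  have -> : F - P i.+1 = (F - P i) - l *: f.
    by rewrite -PP; apply/rowP => j; rewrite !mxE; ring.
  by rewrite bE !det2E !mxE; ring.
set w1 := dotr (f) (F - P i) in hb *.
set w2 := det2 (f) (F - P i) in hdb *.
have e1 : (t i - x) ^+ 2 + y ^+ 2 = w1 ^+ 2 + w2 ^+ 2.
  rewrite -sq /w1 /w2 !expr2 -(plane_decomposition _ _ ff) -[RHS]sqr_enorm -sqr_enorm.
  rewrite -[enorm (F - P i)]/(edist (P i) F) edistC -hd1 hxy hQ.
  by congr (enorm _ ^+ 2); apply/rowP => j; rewrite !mxE; ring.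
have e2 : (t i.+1 - x) ^+ 2 + y ^+ 2 = (l - w1) ^+ 2 + w2 ^+ 2.
  rewrite -hb -(sqrrN w2) -hdb.
  have bb : dotr (bwd i) (bwd i) = 1.
    by rewrite bE dotrNl dotrNr opprK.
  rewrite -sq !expr2 -(plane_decomposition _ _ bb) -[RHS]sqr_enorm -sqr_enorm.
  rewrite -[enorm (F - P i.+1)]/(edist (P i.+1) F) -hd2 edistC hxy hQ'.
  by congr (enorm _ ^+ 2); apply/rowP => j; rewrite !mxE; ring.
have hx : x = t i + w1.
  apply: (mulIf (lt0r_neq0 l0)); rewrite /l in e1 e2 *; nra.
have hy : y = `|w2|.
  apply/eqP; rewrite -(@eqrXn2 _ 2) ?(ltW y0) // real_normK ?num_real //.
  by apply/eqP; rewrite hx in e1; lra.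
rewrite hb hdb normrN; split=> //; rewrite hx /l; ring.
Qed.

End RolledFoci.

Theorem theorem21 (R : realType)
  (A B : 'rV[R]_2) (a : R) (hE : edist A B < 2 * a)
  (P : nat -> 'rV[R]_2) (hP : billiard_trajectory (ellipse A B a) P)
  (o u v : 'rV[R]_3) (huv : orthonormal_pair u v)
  (Q As Bs : nat -> 'rV[R]_3)
  (hQ : rolled_onto o u P Q)
  (hB : rolled_focus o u v P Q B Bs)
  (hA : rolled_focus o u (- v) P Q A As)
  (theta : R) (htheta : forall k : int, theta <> k%:~R * (2 * pi)) :
  let m := surface_of_rotation o u theta Bs in
  let m' := surface_of_rotation o u theta As in
  let s := gauss_map m m' in
  [/\ circular m, circular m' &
    exists H : R,
      [/\ constant_mean_curvature m s H,
          constant_mean_curvature m' (opp_mesh s) H,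
          (forall i, 1 / H = edist (As i) (Bs i))
        & 1 / H = 2 * a]].
Proof.
have [t ht] := hQ; have [hT hcol] := hP.
have [uu vv uv _ _] := orthonormal_pairE huv.
have huv' : orthonormal_pair u (- v).
  case: huv => hu hv h; split=> //; last by rewrite dotrNr h oppr0.
  rewrite -hv; apply: enorm_eq; first exact: enorm_ge0.
  by rewrite sqr_enorm dotrNl dotrNr opprK.
have [x [y [-> hxy]]] := rolled_focus_meridian ht huv hB.
have [X [Y [hAs hXY]]] := rolled_focus_meridian ht huv' hA.
have {hAs}-> : As = meridian o u v X (fun i => - Y i).
  by rewrite hAs; apply/funext => i; rewrite /meridian scalerN scaleNr.
have a0 : 0 < 2 * a by exact: le_lt_trans (enorm_ge0 _) hE.
have l0 i : 0 < edist (P i) (P i.+1).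
  by rewrite (rolled_edge_length ht) // subr_gt0; case: (ht i).
have dist i : (X i - x i) ^+ 2 + (- Y i - y i) ^+ 2 = (2 * a) ^+ 2.
  rewrite (unfolded_focal_distance hE (l0 i) (hT i)).
  have [_ -> <- _ _] := hXY i; have [_ -> <- _ _] := hxy i.
  have -> : B - A = (B - P i) - (A - P i).
    by apply/rowP => j; rewrite !mxE; ring.
  by rewrite (dotrBr (B - P i)); ring.
(* The edges [i] and [i.+1] meet at the vertex P i.+1, from which both are
   measured. *)
have dual i : exists rho, [/\ 0 < rho, x i < x i.+1,
    X i.+1 - X i = rho * (x i.+1 - x i),
    Y i = rho * y i.+1 & Y i.+1 = rho * y i].
  have l0' : 0 < edist (P i.+1) (P i) by rewrite edistC.
  have [l [m [r [c [s [[l_gt0 m_gt0 r_gt0 s_gt0 c_gt] [b1 b2 b3 b4] [a1 a2 a3 a4]]]]]]] :=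
    billiard_vertex_isogonal hE l0' (l0 i.+1) (hT i) (hT i.+1) (hcol i).
  have [_ _ _ xb yb] := hxy i; have [_ _ _ Xb Yb] := hXY i.
  have [_ xf yf _ _] := hxy i.+1; have [_ Xf Yf _ _] := hXY i.+1.
  exists r; rewrite xb xf Xb Xf yb yf Yb Yf b1 b2 b3 b4 a1 a2 a3 a4.
  split=> //; last 3 first.
  - ring.
  - ring.
  - ring.
  have : 0 < (l + m) * (1 + c) by rewrite mulr_gt0; lra.
  lra.
have {dual}[rho hrho] := boolp.choice dual.
have S0 := sin_half_neq0 htheta.
have hx i : x i != x i.+1 by have [_ h _ _ _] := hrho i; rewrite lt_eqF.
have hX i : X i != X i.+1.
  have [h0 h h1 _ _] := hrho i.
  by rewrite lt_eqF // -subr_gt0 h1 mulr_gt0 // subr_gt0.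
have y0 i : 0 < y i by have [] := hxy i.
have Y0 i : 0 < Y i by have [] := hXY i.
move=> m m' s; split.
- by apply: surface_circular => // i; rewrite gt_eqF.
- by apply: surface_circular => // i; rewrite oppr_eq0 gt_eqF.
exists (2 * a)^-1; rewrite div1r invrK; split=> //.
- apply: (@surface_cmc R o u v theta huv S0 x y X (fun i => - Y i) rho) => //.
  + by move=> i; rewrite gt_eqF // addr_gt0.
  + by move=> i; have [] := hrho i.
  + by move=> i; have [_ _ _ -> _] := hrho i; rewrite mulNr.
  + by move=> i; have [_ _ _ _ ->] := hrho i; rewrite mulNr.
- have -> : opp_mesh s = gauss_map m' m.
    apply/funext => i; apply/funext => k; rewrite /opp_mesh /s /gauss_map.
    by rewrite -scalerN opprB -/(edist _ _) edistC.
  apply: (@surface_cmc R o u v theta huv S0 X (fun i => - Y i) x y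
            (fun i => (rho i)^-1)) => //.
  + by move=> i; rewrite -opprD oppr_eq0 gt_eqF // addr_gt0.
  + by move=> i; have [r0 _ -> _ _] := hrho i; rewrite mulKf // gt_eqF.
  + by move=> i; have [r0 _ _ _ ->] := hrho i; rewrite mulrNN mulKf // gt_eqF.
  + by move=> i; have [r0 _ _ -> _] := hrho i; rewrite mulrNN mulKf // gt_eqF.
  + by move=> i; rewrite -(dist i); ring.
- move=> i; apply/esym/enorm_eq; first exact: ltW.
  rewrite -(dist i) /meridian.
  have -> : o + x i *: u + y i *: v - (o + X i *: u + - Y i *: v)
     = (x i - X i) *: u + (y i + Y i) *: v.
    by apply/rowP => j; rewrite !mxE; ring.
  rewrite !(dotrDl, dotrDr, dotrZl, dotrZr) (dotrC v u) uu vv uv; ring.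
Qed.
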